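(* Let $Q(\overline R)$ be a generalized quantifier which is $\Delta^1_1$-definable relative to $\Sigma^1_1\text{-}\mathsf{AC}_0^{\mathsf{wo}}$. Then $Q$ is first-order definable relative to $\Sigma^1_1\text{-}\mathsf{AC}_0^{\mathsf{wo}}$.
   Context: Language: second-order logic with individual variables and, for each $n\ge1$, $n$-ary relation variables, identity, atomic formulas $R\overline x$, and one binary relation symbol $\preceq$ on individuals. A formula is first-order if it has no second-order quantifiers (free second-order variables allowed); it is $\Sigma^1_1$ (resp. $\Pi^1_1$) if it is a block of existential (resp. universal) second-order quantifiers followed by a first-order formula. Provability is many-sorted first-order provability, equivalently truth in all Henkin models: structures $(A,S_1[A],S_2[A],\ldots)$ with $A\ne\emptyset$, $\emptyset\neq S_n[A]\subseteq P(A^n)$, where $n$-ary relation variables range over $S_n[A]$ and $R\overline a$ means $\overline a\in R$. $\Sigma^1_1\text{-}\mathsf{AC}_0^{\mathsf{wo}}$ consists of: extensionality for each arity; comprehension $\exists R\,\forall\overline x\,(R\overline x\leftrightarrow\varphi(\overline x))$ for all first-order $\varphi$ (which may contain $\preceq$ and parameters; $R$ not free in $\varphi$); the schema $\forall\overline x\,\exists R\,\varphi(\overline x,R)\rightarrow\exists R'\,\forall\overline x\,\varphi(\overline x,R'[\overline x])$ for $\Sigma^1_1$ formulas $\varphi$ (parameters allowed), where $R'[\overline x]=\{\overline y:R'\overline x\,\overline y\}$; and axioms saying $\preceq$ is a well-order of the individuals: reflexive, antisymmetric, transitive, linear, and $\forall X\,((\exists x\,Xx)\to\exists x_0\,(Xx_0\wedge\forall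 y\,(Xy\to x_0\preceq y)))$. A generalized quantifier is a formula $Q(R_1,\ldots,R_\ell)$ of this language whose only free variables are the displayed second-order variables. $Q$ is $\Sigma^1_1$-definable (resp. $\Pi^1_1$-definable, first-order definable) relative to $T$ if there is a $\Sigma^1_1$ (resp. $\Pi^1_1$, first-order) formula $\Phi(\overline R)$ with exactly the displayed free variables such that $T$ proves $\forall\overline R\,(Q(\overline R)\leftrightarrow\Phi(\overline R))$; it is $\Delta^1_1$-definable if it is both $\Sigma^1_1$- and $\Pi^1_1$-definable. *)

(* Defs.v *)
From mathcomp Require Import all_boot.
From mathcomp Require Import classical_sets.

Set Implicit Arguments.
Unset Strict Implicit.
Unset Printing Implicit Defensive.

Local Open Scope classical_set_scope.

(* Individual variables are natural numbers.  The relation variable (n, i) is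
   the i-th variable of arity n + 1, so that only arities >= 1 occur. *)
Notation relvar := (nat * nat)%type.

Definition arity (X : relvar) : nat := X.1.+1.

(* Identity is available in every sort; Eq2 n i j is the identity of the
   relation variables (n, i) and (n, j). *)
Inductive formula : Type :=
| Eq1 of nat & nat
| Eq2 of nat & nat & nat
| Prec of nat & nat
| Rel (X : relvar) of (arity X).-tuple nat
| Not of formula
| And of formula & formula
| Or of formula & formula
| Imp of formula & formula
| All1 of nat & formula
| Ex1 of nat & formula
| All2 of relvar & formula
| Ex2 of relvar & formula.

Definition Iff (p q : formula) : formula := And (Imp p q) (Imp q p).

Definition All1s (xs : seq nat) (p : formula) : formula := foldr All1 p xs.
Definition All2s (Xs : seq relvar) (p : formula) : formula := foldr All2 p Xs.

Fixpoint fv1 (p : formula) : seq nat :=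
  match p with
  | Eq1 x y | Prec x y => [:: x; y]
  | Eq2 _ _ _ => [::]
  | Rel _ xs => xs
  | Not p => fv1 p
  | And p q | Or p q | Imp p q => fv1 p ++ fv1 q
  | All1 x p | Ex1 x p => [seq y <- fv1 p | y != x]
  | All2 _ p | Ex2 _ p => fv1 p
  end.

Fixpoint fv2 (p : formula) : seq relvar :=
  match p with
  | Eq1 _ _ | Prec _ _ => [::]
  | Eq2 n i j => [:: (n, i); (n, j)]
  | Rel X _ => [:: X]
  | Not p => fv2 p
  | And p q | Or p q | Imp p q => fv2 p ++ fv2 q
  | All1 _ p | Ex1 _ p => fv2 p
  | All2 X p | Ex2 X p => [seq Y <- fv2 p | Y != X]
  end.

Fixpoint first_order (p : formula) : bool :=
  match p with
  | Eq1 _ _ | Eq2 _ _ _ | Prec _ _ | Rel _ _ => true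
  | Not p | All1 _ p | Ex1 _ p => first_order p
  | And p q | Or p q | Imp p q => first_order p && first_order q
  | All2 _ _ | Ex2 _ _ => false
  end.

Fixpoint sigma11 (p : formula) : bool :=
  if p is Ex2 _ q then sigma11 q else first_order p.

Fixpoint pi11 (p : formula) : bool :=
  if p is All2 _ q then pi11 q else first_order p.

Record henkin : Type := Henkin {
  carrier : Type;
  carrier_neq0 : [set: carrier] !=set0;
  prec : carrier -> carrier -> Prop;
  (* rels n is the range of the relation variables of arity n + 1 *)
  rels : forall n : nat, set (set (n.+1.-tuple carrier));
  rels_neq0 : forall n, @rels n !=set0
}.
Arguments rels : clear implicits.

Definition assignment1 (M : henkin) : Type := nat -> carrier M.
Definition assignment2 (M : henkin) : Type :=
  forall X : relvar, set ((arity X).-tuple (carrier M)).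

Fixpoint sat (M : henkin) (v : assignment1 M) (V : assignment2 M)
    (p : formula) : Prop :=
  match p with
  | Eq1 x y => v x = v y
  | Eq2 n i j => V (n, i) = V (n, j)
  | Prec x y => prec (v x) (v y)
  | Rel X xs => V X [tuple of map v xs]
  | Not p => ~ sat v V p
  | And p q => sat v V p /\ sat v V q
  | Or p q => sat v V p \/ sat v V q
  | Imp p q => sat v V p -> sat v V q
  | All1 x p => forall a, sat (dfwith v (i := x) a) V p
  | Ex1 x p => exists a, sat (dfwith v (i := x) a) V p
  | All2 X p => forall R, rels M X.1 R -> sat v (dfwith V (i := X) R) p
  | Ex2 X p => exists2 R, rels M X.1 R & sat v (dfwith V (i := X) R) p
  end.

(* Free variables are read universally. *)
Definition valid_in (M : henkin) (p : formula) : Prop :=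
  forall (v : assignment1 M) (V : assignment2 M),
    (forall X, rels M X.1 (V X)) -> sat v V p.

Definition theory : Type := set formula.

Definition is_model (T : theory) (M : henkin) : Prop :=
  forall p, T p -> valid_in M p.

(* Many-sorted first-order provability, as truth in all Henkin models. *)
Definition proves (T : theory) (p : formula) : Prop :=
  forall M : henkin, is_model T M -> valid_in M p.

Definition extensionality_ax (n : nat) : formula :=
  let X := (n, 0) in let Y := (n, 1) in
  let xs := [tuple of iota 0 n.+1] in
  All2 X (All2 Y
    (Imp (All1s xs (Iff (@Rel X xs) (@Rel Y xs))) (Eq2 n 0 1))).

Definition comprehension_ax (X : relvar) (xs : (arity X).-tuple nat)
    (p : formula) : formula :=
  Ex2 X (All1s xs (Iff (Rel xs) p)).

(* The variable written R' in
     forall xs, exists X, p(xs, X) -> exists R', forall xs, p(xs, R'[xs]),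
   where xs has length k + 1. *)
Definition choice_var (k : nat) (X : relvar) (j : nat) : relvar :=
  (k + arity X, j).

(* X = R'[xs], i.e. forall ys, (X ys <-> R' xs ys). *)
Definition is_section (k : nat) (xs : k.+1.-tuple nat) (X : relvar) (j : nat)
    (ys : (arity X).-tuple nat) : formula :=
  All1s ys (Iff (Rel ys) (@Rel (choice_var k X j) [tuple of xs ++ ys])).

(* R'[xs] is a set term and not a variable, so p(xs, R'[xs]) is written
   exists X, (X = R'[xs] /\ p(xs, X)); this also prevents any capture of xs. *)
Definition choice_ax (k : nat) (xs : k.+1.-tuple nat) (X : relvar) (j : nat)
    (ys : (arity X).-tuple nat) (p : formula) : formula :=
  Imp (All1s xs (Ex2 X p))
      (Ex2 (choice_var k X j)
         (All1s xs (Ex2 X (And (is_section xs j ys) p)))).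

Definition prec_refl_ax : formula := All1 0 (Prec 0 0).

Definition prec_antisym_ax : formula :=
  All1s [:: 0; 1] (Imp (And (Prec 0 1) (Prec 1 0)) (Eq1 0 1)).

Definition prec_trans_ax : formula :=
  All1s [:: 0; 1; 2] (Imp (And (Prec 0 1) (Prec 1 2)) (Prec 0 2)).

Definition prec_linear_ax : formula :=
  All1s [:: 0; 1] (Or (Prec 0 1) (Prec 1 0)).

Definition prec_least_ax : formula :=
  let X : relvar := (0, 0) in
  let mem x := @Rel X [tuple x] in
  All2 X (Imp (Ex1 0 (mem 0))
              (Ex1 0 (And (mem 0) (All1 1 (Imp (mem 1) (Prec 0 1)))))).

Inductive sigma11_AC0_wo : theory :=
| ax_extensionality n : sigma11_AC0_wo (extensionality_ax n)
| ax_comprehension (X : relvar) (xs : (arity X).-tuple nat) (p : formula) of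
    uniq xs & first_order p & X \notin fv2 p :
    sigma11_AC0_wo (comprehension_ax xs p)
| ax_choice (k : nat) (xs : k.+1.-tuple nat) (X : relvar) (j : nat)
    (ys : (arity X).-tuple nat) (p : formula) of
    uniq (xs ++ ys) & sigma11 p & choice_var k X j \notin fv2 p :
    sigma11_AC0_wo (choice_ax xs j ys p)
| ax_prec_refl : sigma11_AC0_wo prec_refl_ax
| ax_prec_antisym : sigma11_AC0_wo prec_antisym_ax
| ax_prec_trans : sigma11_AC0_wo prec_trans_ax
| ax_prec_linear : sigma11_AC0_wo prec_linear_ax
| ax_prec_least : sigma11_AC0_wo prec_least_ax.

Definition generalized_quantifier (Rs : seq relvar) (Q : formula) : Prop :=
  [/\ uniq Rs, fv1 Q = [::] & {subset fv2 Q <= Rs}].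

Definition definable_by (C : pred formula) (T : theory) (Rs : seq relvar)
    (Q : formula) : Prop :=
  exists Phi : formula,
    [/\ C Phi, fv1 Phi = [::], fv2 Phi =i Rs & proves T (All2s Rs (Iff Q Phi))].

Definition sigma11_definable := definable_by sigma11.
Definition pi11_definable := definable_by pi11.
Definition first_order_definable := definable_by first_order.

Definition delta11_definable (T : theory) (Rs : seq relvar) (Q : formula) : Prop :=
  sigma11_definable T Rs Q /\ pi11_definable T Rs Q.

(* Main.v *)
Require Import Defs.
From mathcomp Require Import all_boot.
From mathcomp Require Import boolp classical_sets filter.

(** Idea (after Barwise and Schlipf).  If a structure (B, <=, R) is saturated for
countable sets of first-order formulas and its definable sets have least
elements, then B together with its definable sets is a model of
Sigma^1_1-AC_0^wo: by saturation finitely many defining formulas suffice for a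
choice instance, and taking the least formula and lexicographically least
parameters makes the choice definable.

Let Q be equivalent to "exists X, phi" and to "forall Y, psi".  For a defining
formula chi let theta_chi(R) and theta'_chi(R) be the first-order sentences
"phi holds for some instance of chi" and "psi fails for some instance of chi".
If every finite set of the theta_chi, theta'_chi failed in some model, an
ultraproduct over nat of such models would be a saturated B in which all of
them fail.  But in B with its definable sets either Q or its negation holds,
and its witness is definable.  So some finite disjunctions satisfy
T |- Theta \/ Theta'; as Theta implies Q and Theta' implies not Q, the sentence
Theta defines Q. *)

Set Implicit Arguments.
Unset Strict Implicit.
Unset Printing Implicit Defensive.

(** * Blocks of quantifiers and agreement of assignments *)

Definition agree_off (T : eqType) (A : T -> Type) (xs : seq T)
  (u v : forall x, A x) := forall x, x \notin xs -> u x = v x.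

Lemma dfwith_self (T : eqType) (A : T -> Type) (v : forall x, A x) x :
  dfwith v (v x) = v.
Proof.
by apply: functional_extensionality_dep => y; case: (dfwithP v (v x) y).
Qed.

Lemma dfwithK (T : eqType) (A : T -> Type) (v : forall x, A x) x (a b : A x) :
  dfwith (dfwith v a) b = dfwith v b.
Proof.
apply: functional_extensionality_dep => y; have [<-|ne] := eqVneq x y.
  by rewrite !dfwith_in.
by rewrite !dfwith_out.
Qed.

Lemma agree_off_cons (T : eqType) (A : T -> Type) x xs (u v : forall x, A x) :
  agree_off (x :: xs) u v <-> agree_off xs u (dfwith v (u x)).
Proof.
split=> uv y.
  have [<- _|ne yxs] := eqVneq x y; first by rewrite dfwith_in.
  by rewrite dfwith_out // uv // inE eq_sym (negPf ne).
rewrite inE negb_or => /andP[ne yxs].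
by rewrite uv // dfwith_out // eq_sym.
Qed.

Lemma sat_All1s (M : henkin) (v : assignment1 M) (V : assignment2 M) xs p :
  sat v V (All1s xs p) <-> forall u, agree_off xs u v -> sat u V p.
Proof.
elim: xs v => [|x xs IH] v /=.
  split=> [pv u uv|]; last exact.
  by have -> : u = v by apply: funext => y; apply: uv.
split=> [pv u /agree_off_cons uv|pv a]; first exact: (IH _).1 (pv _) _ uv.
apply/IH => u ua; apply: pv => y; rewrite inE negb_or => /andP[ne yxs].
by rewrite ua // dfwith_out // eq_sym.
Qed.

Definition Ex1s (xs : seq nat) (p : formula) := foldr Ex1 p xs.
Definition Ex2s (Xs : seq relvar) (p : formula) := foldr Ex2 p Xs.

Lemma sat_Ex1s (M : henkin) (v : assignment1 M) (V : assignment2 M) xs p :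
  sat v V (Ex1s xs p) <-> exists2 u, agree_off xs u v & sat u V p.
Proof.
elim: xs v => [|x xs IH] v /=.
  split=> [pv|[u uv]]; first by exists v.
  by have -> : v = u by apply: funext => y; rewrite uv.
split=> [[a /IH[u ua pu]]|[u /agree_off_cons uv pu]].
  exists u => // y; rewrite inE negb_or => /andP[ne yxs].
  by rewrite ua // dfwith_out // eq_sym.
by exists (u x); apply/IH; exists u.
Qed.

Definition full (M : henkin) (V : assignment2 M) := forall X, rels M X.1 (V X).

Lemma ex_full (M : henkin) : exists V : assignment2 M, full V.
Proof.
exists (fun X => projT1 (cid (@rels_neq0 M X.1))) => X.
by case: (cid _).
Qed.

Lemma full_dfwith (M : henkin) (V : assignment2 M) X R :
  full V -> rels M X.1 R -> full (dfwith V (i := X) R).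
Proof. by move=> fV RX Y; case: dfwithP. Qed.

Lemma sat_Ex2s (M : henkin) (v : assignment1 M) (V : assignment2 M) Xs p :
  full V -> sat v V (Ex2s Xs p) <->
  exists V', [/\ agree_off Xs V' V, full V' & sat v V' p].
Proof.
elim: Xs V => [|X Xs IH] V fV /=.
  split=> [pv|[V' [V'V fV' pV']]]; first by exists V.
  by have -> : V = V' by apply: functional_extensionality_dep => y; rewrite V'V.
split=> [[R RX /(IH _ (full_dfwith fV RX))[V' [V'R fV' pV']]]|].
  exists V'; split=> // Y; rewrite inE negb_or => /andP[ne YXs].
  by rewrite V'R // dfwith_out // eq_sym.
case=> V' [/agree_off_cons V'V fV' pV'].
by exists (V' X) => //; apply/IH; [apply: full_dfwith | exists V'].
Qed.

Lemma valid_All2s (M : henkin) Xs p :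
  valid_in M (All2s Xs p) <-> valid_in M p.
Proof.
elim: Xs => [//|X Xs IH]; rewrite -IH /=; split=> pM v V fV.
  by have := pM v V fV _ (fV X); rewrite dfwith_self.
by move=> R RX; apply: pM; apply: full_dfwith.
Qed.

Lemma sat_All2s_Not (M : henkin) (v : assignment1 M) V Xs p :
  sat v V (All2s Xs p) <-> ~ sat v V (Ex2s Xs (Not p)).
Proof.
elim: Xs V => [|X Xs IH] V /=.
  by split=> [|/contrapT//]; move=> ? [].
split=> [h [R RX]|h R RX]; first exact/IH/h.
by apply/IH => nh; apply: h; exists R.
Qed.

(** Allows a $\Pi^1_1$ formula to be handled through the existential form of its negation. *)
Lemma fv_Ex2s_All2s Xs p : fv1 (Ex2s Xs (Not p)) = fv1 (All2s Xs p) /\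
  fv2 (Ex2s Xs (Not p)) = fv2 (All2s Xs p).
Proof. by elim: Xs => //= X Xs [-> ->]. Qed.

Lemma fv1_Ex1s xs p : fv1 (Ex1s xs p) = [seq y <- fv1 p | y \notin xs].
Proof.
elim: xs => [|x xs IH] /=; first by rewrite filter_predT.
by rewrite IH -filter_predI; apply: eq_filter => y /=; rewrite inE negb_or.
Qed.

Lemma sigma11_Ex2s p : sigma11 p ->
  exists Xs p0, first_order p0 /\ p = Ex2s Xs p0.
Proof.
elim: p => [x y|n i j|x y|X xs|p _|p _ q _|p _ q _|p _ q _|x p _|x p _|X p _|X p IH];
  try by move=> sp; exists [::]; eexists; split; first exact: sp.
by move=> /= /IH[Xs [p0 [fp0 ->]]]; exists (X :: Xs), p0.
Qed.

Lemma pi11_All2s p : pi11 p ->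
  exists Xs p0, first_order p0 /\ p = All2s Xs p0.
Proof.
elim: p => [x y|n i j|x y|X xs|p _|p _ q _|p _ q _|p _ q _|x p _|x p _|X p IH|X p _];
  try by move=> sp; exists [::]; eexists; split; first exact: sp.
by move=> /= /IH[Xs [p0 [fp0 ->]]]; exists (X :: Xs), p0.
Qed.

Lemma sat_ext (M : henkin) p (u v : assignment1 M) (V V' : assignment2 M) :
    {in fv1 p, u =1 v} -> (forall X, X \in fv2 p -> V X = V' X) ->
  sat u V p <-> sat v V' p.
Proof.
elim: p u v V V' => [x y|n i j|x y|X xs|p IH|p IHp q IHq|p IHp q IHq
  |p IHp q IHq|x p IH|x p IH|X p IH|X p IH] u v V V' /= uv VV'.
- by rewrite !uv // !inE eqxx ?orbT.
- by rewrite !VV' // !inE eqxx ?orbT.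
- by rewrite !uv // !inE eqxx ?orbT.
- have -> : [tuple of map u xs] = [tuple of map v xs].
    by apply/val_inj/eq_in_map.
  by rewrite VV' // inE.
- by rewrite (IH u v V V').
- have Ep : sat u V p <-> sat v V' p.
    by apply: IHp => X XX; [apply: uv | apply: VV']; rewrite mem_cat XX.
  have Eq : sat u V q <-> sat v V' q.
    by apply: IHq => X XX; [apply: uv | apply: VV']; rewrite mem_cat XX orbT.
  tauto.
- have Ep : sat u V p <-> sat v V' p.
    by apply: IHp => X XX; [apply: uv | apply: VV']; rewrite mem_cat XX.
  have Eq : sat u V q <-> sat v V' q.
    by apply: IHq => X XX; [apply: uv | apply: VV']; rewrite mem_cat XX orbT.
  tauto.
- have Ep : sat u V p <-> sat v V' p.
    by apply: IHp => X XX; [apply: uv | apply: VV']; rewrite mem_cat XX.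
  have Eq : sat u V q <-> sat v V' q.
    by apply: IHq => X XX; [apply: uv | apply: VV']; rewrite mem_cat XX orbT.
  tauto.
- have E a : sat (dfwith u (i := x) a) V p <-> sat (dfwith v (i := x) a) V' p.
    apply: IH => // y yp; have [<-|ne] := eqVneq x y; first by rewrite !dfwith_in.
    by rewrite !dfwith_out // uv // mem_filter eq_sym ne.
  by split=> h a; apply/E.
- have E a : sat (dfwith u (i := x) a) V p <-> sat (dfwith v (i := x) a) V' p.
    apply: IH => // y yp; have [<-|ne] := eqVneq x y; first by rewrite !dfwith_in.
    by rewrite !dfwith_out // uv // mem_filter eq_sym ne.
  by split=> -[a h]; exists a; apply/E.
- have E R : sat u (dfwith V (i := X) R) p <-> sat v (dfwith V' (i := X) R) p.
    apply: IH => // Y Yp; have [<-|ne] := eqVneq X Y; first by rewrite !dfwith_in.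
    by rewrite !dfwith_out // VV' // mem_filter eq_sym ne.
  by split=> h R RX; apply/E/h.
- have E R : sat u (dfwith V (i := X) R) p <-> sat v (dfwith V' (i := X) R) p.
    apply: IH => // Y Yp; have [<-|ne] := eqVneq X Y; first by rewrite !dfwith_in.
    by rewrite !dfwith_out // VV' // mem_filter eq_sym ne.
  by split=> -[R RX h]; exists R => //; apply/E.
Qed.

(** * Tuples and parameter streams inside one assignment *)

Definition scat A (s : seq A) (w : nat -> A) (j : nat) : A :=
  nth (w (j - size s)) s j.

(** Simultaneous update: for [y] outside [xs] the index is [size xs], so that a [t] of this size
    leaves the default [v y]. *)
Definition upd A (v : nat -> A) (xs : seq nat) (t : seq A) (y : nat) : A :=
  nth (v y) t (index y xs).

(* An assignment carries two streams: individual variables at even positions,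
   parameters of definable sets at odd positions. *)
Definition mix A (u w : nat -> A) (j : nat) : A :=
  if odd j then w j./2 else u j./2.

Definition evens A (v : nat -> A) (j : nat) := v j.*2.
Definition odds A (v : nat -> A) (j : nat) := v j.*2.+1.

Lemma evens_mix A (u w : nat -> A) : evens (mix u w) = u.
Proof. by apply: funext => j; rewrite /evens /mix odd_double doubleK. Qed.

Lemma odds_mix A (u w : nat -> A) : odds (mix u w) = w.
Proof. by apply: funext => j; rewrite /odds /mix /= odd_double /= uphalf_double. Qed.

Lemma odds_half A (v : nat -> A) y : odd y -> odds v y./2 = v y.
Proof. by move=> oy; rewrite /odds -[in RHS](odd_double_half y) oy. Qed.

Lemma mix_evens_odds A (v : nat -> A) : mix (evens v) (odds v) = v.
Proof.
apply: funext => j; rewrite /mix /evens /odds -[in RHS](odd_double_half j).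
by case: (odd j).
Qed.

Lemma comp_mix A B (h : A -> B) u w : h \o mix u w = mix (h \o u) (h \o w).
Proof. by apply: funext => j; rewrite /mix /=; case: odd. Qed.

Lemma comp_scat A B (h : A -> B) s w : h \o scat s w = scat (map h s) (h \o w).
Proof.
apply: funext => j; rewrite /scat /= size_map.
have [js|sj] := ltnP j (size s); first by rewrite (nth_map (w (j - size s))).
by rewrite !nth_default ?size_map.
Qed.

Lemma comp_upd A B (h : A -> B) v xs t :
  h \o upd v xs t = upd (h \o v) xs (map h t).
Proof.
apply: funext => y; rewrite /upd /=.
have [js|sj] := ltnP (index y xs) (size t); first by rewrite (nth_map (v y)).
by rewrite !nth_default ?size_map.
Qed.

Lemma scat_addn A (s : seq A) w j : scat s w (size s + j) = w j.
Proof. by rewrite /scat nth_default ?leq_addr // addKn. Qed.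

Lemma scat_cat A (s t : seq A) w : scat (s ++ t) w = scat s (scat t w).
Proof.
apply: funext => j; rewrite /scat nth_cat; case: ltnP => [js|sj].
  exact: set_nth_default.
by rewrite size_cat subnDA [in RHS]nth_default.
Qed.

Lemma map_scat A (s : seq A) w n :
  n = size s -> map (scat s w) (iota 0 n) = s.
Proof.
move=> ->; case: s => [//|x s]; apply: (@eq_from_nth _ x) => [|i].
  by rewrite size_map size_iota.
rewrite size_map size_iota => ix; rewrite (nth_map 0) ?size_iota // nth_iota //.
exact: set_nth_default.
Qed.

Lemma map_scat_addn A (s : seq A) w m n :
  m = size s -> map (scat s w) (iota m n) = map w (iota 0 n).
Proof.
move=> ->; rewrite -{1}[size s]addn0 iotaDl -map_comp.
by apply: eq_map => j /=; rewrite scat_addn.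
Qed.

Lemma upd_agree A (v : nat -> A) xs t :
  size t = size xs -> agree_off xs (upd v xs t) v.
Proof. by move=> st y yxs; rewrite /upd nth_default // st leqNgt index_mem. Qed.

Lemma map_upd A (v : nat -> A) xs t :
  uniq xs -> size t = size xs -> map (upd v xs t) xs = t.
Proof.
move=> uxs st; case: xs uxs st => [|x xs] uxs st; first by case: t st.
apply: (@eq_from_nth _ (v 0)) => [|i]; rewrite size_map // => ix.
by rewrite (nth_map 0) // /upd index_uniq //; apply: set_nth_default; rewrite st.
Qed.

Lemma tuple_map_upd A n (v : nat -> A) (xs : n.-tuple nat) (t : n.-tuple A) :
  uniq xs -> [tuple of map (upd v xs t) xs] = t.
Proof. by move=> uxs; apply/val_inj/map_upd; rewrite // !size_tuple. Qed.

Lemma agree_upd A (u v : nat -> A) xs :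
  agree_off xs u v -> u = upd v xs (map u xs).
Proof.
move=> uv; apply: funext => y; rewrite /upd; have [yxs|yxs] := boolP (y \in xs).
  by rewrite (nth_map y) ?index_mem // nth_index.
by rewrite nth_default ?uv // size_map leqNgt index_mem.
Qed.

Lemma evens_dfwith A (v : nat -> A) x a :
  evens (dfwith v (i := x.*2) a) = dfwith (evens v) (i := x) a.
Proof.
apply: funext => y; have [<-|ne] := eqVneq x y; first by rewrite /evens !dfwith_in.
by rewrite /evens !dfwith_out // (inj_eq double_inj).
Qed.

Lemma odds_dfwith A (v : nat -> A) x a :
  odds (dfwith v (i := x.*2) a) = odds v.
Proof.
apply: funext => y; rewrite /odds dfwith_out //.
by apply/eqP => /(congr1 odd) /=; rewrite !odd_double.
Qed.

(** * Uniform first-order definability *)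

(* Normal forms of the first-order formulas over Rs.  Eq2 can be left out since
   relations in a henkin structure are extensional. *)
Inductive core (Rs : seq relvar) : formula -> Prop :=
| core_Eq1 x y : core Rs (Eq1 x y)
| core_Prec x y : core Rs (Prec x y)
| core_Rel X xs of X \in Rs : core Rs (@Rel X xs)
| core_Not p of core Rs p : core Rs (Not p)
| core_And p q of core Rs p & core Rs q : core Rs (And p q)
| core_Ex1 x p of core Rs p : core Rs (Ex1 x p).

Lemma core_first_order Rs p : core Rs p -> first_order p.
Proof. by elim=> //= {}p q _ -> _ ->. Qed.

Lemma core_fv2 Rs p : core Rs p -> {subset fv2 p <= Rs}.
Proof.
elim=> //= [X xs XRs Y|{}p q _ sp _ sq Y]; first by rewrite inE => /eqP->.
by rewrite mem_cat => /orP[/sp|/sq].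
Qed.

(* Definability is by a single formula in all structures at once; its closure
   properties stand in for substitution on the syntax. *)
Definition upred := forall M : henkin, assignment2 M -> assignment1 M -> Prop.

Definition def (Rs : seq relvar) (P : upred) :=
  exists2 p, core Rs p & forall M W v, P M W v <-> @sat M v W p.

Section Definability.
Variable Rs : seq relvar.
Implicit Types P Q : upred.

Lemma def_ext P Q :
  (forall M W v, Q M W v <-> P M W v) -> def Rs P -> def Rs Q.
Proof. by move=> PQ [p cp Pp]; exists p => // M W v; rewrite PQ. Qed.

Lemma def_sat p : core Rs p -> def Rs (fun M W v => sat v W p).
Proof. by exists p. Qed.

Lemma def_not P : def Rs P -> def Rs (fun M W v => ~ P M W v).
Proof.
by move=> [p cp Pp]; exists (Not p) => [|M W v]; [constructor|rewrite Pp].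
Qed.

Lemma def_and P Q : def Rs P -> def Rs Q -> def Rs (fun M W v => P M W v /\ Q M W v).
Proof.
move=> [p cp Pp] [q cq Qq]; exists (And p q) => [|M W v]; first by constructor.
by rewrite Pp Qq.
Qed.

Lemma def_ex x P :
  def Rs P -> def Rs (fun M W v => exists a, P M W (dfwith v (i := x) a)).
Proof.
move=> [p cp Pp]; exists (Ex1 x p) => [|M W v /=]; first by constructor.
by split=> -[a /Pp]; exists a.
Qed.

Lemma def_or P Q : def Rs P -> def Rs Q -> def Rs (fun M W v => P M W v \/ Q M W v).
Proof.
move=> dP dQ; apply: def_ext (def_not (def_and (def_not dP) (def_not dQ))).
by move=> M W v; have [|] := pselect (P M W v); have [|] := pselect (Q M W v); tauto.
Qed.

Lemma def_imp P Q :
  def Rs P -> def Rs Q -> def Rs (fun M W v => P M W v -> Q M W v).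
Proof.
move=> dP dQ; apply: def_ext (def_not (def_and dP (def_not dQ))).
by move=> M W v; have [|] := pselect (Q M W v); tauto.
Qed.

Lemma def_iff P Q :
  def Rs P -> def Rs Q -> def Rs (fun M W v => P M W v <-> Q M W v).
Proof. by move=> dP dQ; apply: def_and; apply: def_imp. Qed.

Lemma def_all x P :
  def Rs P -> def Rs (fun M W v => forall a, P M W (dfwith v (i := x) a)).
Proof.
move=> dP; apply: def_ext (def_not (def_ex x (def_not dP))) => M W v.
split=> [Pa [a]|nP a]; first exact.
by apply: contrapT => nPa; apply: nP; exists a.
Qed.

Lemma def_False : def Rs (fun _ _ _ => False).
Proof.
have d : def Rs (fun M _ v => v 0 = v 0) by exists (Eq1 0 0) => //; constructor.
by apply: def_ext (def_not d) => M W v; tauto.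
Qed.

Lemma def_bigor (P_ : nat -> upred) N :
  (forall n, def Rs (P_ n)) -> def Rs (fun M W v => exists2 n, n < N & P_ n M W v).
Proof.
move=> dP; elim: N => [|N IH].
  by apply: def_ext def_False => M W v; split=> // -[].
apply: def_ext (def_or IH (dP N)) => M W v; split=> [[n]|[[n nN Pn]|PN]].
- by rewrite ltnS leq_eqVlt => /predU1P[->|nN] Pn; [right|left; exists n].
- by exists n => //; apply: ltnW.
- by exists N.
Qed.

(** Renaming by an arbitrary, possibly non-injective map; only the bound variable needs care. *)
Lemma core_comp p : core Rs p ->
  forall f : nat -> nat, def Rs (fun M W v => sat (v \o f) W p).
Proof.
elim=> [x y|x y|X xs XRs|{}p cp IH|{}p q cp IHp cq IHq|x {}p cp IH] f /=.
- by exists (Eq1 (f x) (f y)) => //; constructor.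
- by exists (Prec (f x) (f y)) => //; constructor.
- exists (@Rel X [tuple of map f xs]) => [|M W v /=]; first by constructor.
  set t := [tuple of _]; set t' := [tuple of _].
  by have -> : t = t' by apply: val_inj; rewrite /= map_comp.
- exact: def_not.
- exact: def_and.
(* [z] exceeds the images of all free variables of [p], so nothing is captured. *)
pose z := (\max_(y <- fv1 p) f y).+1.
apply: def_ext (def_ex z (IH (dfwith f (i := x) z))) => M W v.
suff E a : sat (dfwith (v \o f) (i := x) a) W p <->
    sat (dfwith v (i := z) a \o dfwith f (i := x) z) W p.
  by split=> -[a pa]; exists a; apply/E.
apply: sat_ext => // y yp /=; have [<-|ne] := eqVneq x y.
  by rewrite !dfwith_in.
rewrite !dfwith_out // neq_ltn; apply/orP; right.
by rewrite ltnS (leq_bigmax_seq y).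
Qed.

Lemma def_comp P (f : nat -> nat) :
  def Rs P -> def Rs (fun M W v => P M W (v \o f)).
Proof.
by case=> p cp Pp; apply: def_ext (core_comp cp f) => M W v; rewrite Pp.
Qed.

Lemma def_exs P xs :
  def Rs P -> def Rs (fun M W v => exists2 u, agree_off xs u v & P M W u).
Proof.
case=> p cp Pp; exists (Ex1s xs p) => [|M W v].
  by elim: xs => //= x xs cs; constructor.
by rewrite sat_Ex1s; split=> -[u uv /Pp]; exists u.
Qed.

Lemma def_alls P xs :
  def Rs P -> def Rs (fun M W v => forall u, agree_off xs u v -> P M W u).
Proof.
move=> dP; apply: def_ext (def_not (def_exs xs (def_not dP))) => M W v.
split=> [Pu [u uv]|nP u uv]; first by apply; apply: Pu.
by apply: contrapT => nPa; apply: nP; exists u.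
Qed.

Lemma def_min P z : def Rs P -> def Rs (fun M W v =>
  P M W v /\ forall b, P M W (dfwith v (i := z) b) -> prec (v z) b).
Proof.
(* [y] differs from [z] and from every free variable of [p], so it can carry the competitor [b]. *)
case=> p cp Pp; pose y := (maxn z (\max_(x <- fv1 p) x)).+1.
have zy : z != y by rewrite neq_ltn ltnS leq_maxl.
have dprec : def Rs (fun M _ v => prec (v z) (v y)).
  by exists (Prec z y) => //; constructor.
have dp := core_comp cp (dfwith id (i := z) y).
apply: def_ext (def_and (def_sat cp) (def_all y (def_imp dp dprec))) => M W v.
suff E b : P M W (dfwith v (i := z) b) <->
    sat (dfwith v (i := y) b \o dfwith id (i := z) y) W p.
  have F b : dfwith v (i := y) b z = v z by rewrite dfwith_out // eq_sym.
  by rewrite -Pp; split=> -[Pv h]; split=> // b /E /h; rewrite F dfwith_in.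
rewrite Pp; apply: sat_ext => // x xp /=; have [<-|ne] := eqVneq z x.
  by rewrite !dfwith_in.
rewrite !dfwith_out // neq_ltn; apply/orP; right.
by rewrite ltnS leq_max (leq_bigmax_seq x) ?orbT.
Qed.

(** The quantifier over whole streams is first-order because the defining formula has only finitely
    many odd variables. *)
Lemma def_ex_odds P :
  def Rs P -> def Rs (fun M W v => exists z, P M W (mix v z)).
Proof.
case=> p cp Pp; pose zs := [seq y <- fv1 p | odd y].
(* [half] puts [v j] at the positions [j.*2] and [j.*2.+1]; the odd copies that [p] reads are
   quantified over. *)
apply: def_ext (def_comp half (def_exs zs (def_sat cp))) => M W v.
split=> [[z /Pp pz]|[u uv pu]].
  exists (fun y => if y \in zs then mix v z y else v y./2).
    by move=> y /negPf ->.
  apply: (iffLR (sat_ext _ _)) pz => // y yp; rewrite mem_filter yp andbT /mix.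
  by case: odd.
exists (odds u); apply/Pp; suff -> : mix v (odds u) = u by [].
rewrite -[RHS]mix_evens_odds; congr mix; apply: funext => j.
rewrite /evens uv /= ?doubleK // mem_filter negb_and odd_double //.
Qed.

End Definability.

Lemma def_fo Rs p : first_order p -> {subset fv2 p <= Rs} ->
  def Rs (fun M W v => sat v W p).
Proof.
elim: p => [x y|n i j|x y|X xs|p IH|p IHp q IHq|p IHp q IHq
  |p IHp q IHq|x p IH|x p IH|X p IH|X p IH] //=.
- by move=> _ _; apply: (@def_sat _ (Eq1 x y)); constructor.
(* Identity of relations is replaced by coextensiveness, tested on distinct variables [xs]. *)
- move=> _ sRs; pose xs : n.+1.-tuple nat := [tuple of iota 0 n.+1].
  have uxs : uniq xs by apply: iota_uniq.
  clearbody xs; have d k : (n, k) \in Rs -> def Rs (fun M W v => sat v W (@Rel (n, k) xs)).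
    by move=> kRs; apply: def_sat; constructor.
  have di := d i (sRs _ (mem_head _ _)).
  have dj : def Rs (fun M W v => sat v W (@Rel (n, j) xs)).
    by apply/d/sRs; rewrite !inE eqxx orbT.
  apply: def_ext (def_alls xs (def_iff di dj)) => M W v /=.
  split=> [-> //|h]; apply/seteqP; split=> t Wt;
    (have := h (upd v xs t) (upd_agree v _); rewrite !size_tuple => /(_ erefl));
    by rewrite /= tuple_map_upd //; tauto.
- by move=> _ _; apply: (@def_sat _ (Prec x y)); constructor.
- by move=> _ sRs; apply: (@def_sat _ (@Rel X xs)); constructor; apply: sRs; rewrite inE.
- by move=> fp sRs; apply: def_not; apply: IH.
- case/andP=> fp fq sRs; apply: def_and; [apply: IHp|apply: IHq] => //;
    by move=> X XX; apply: sRs; rewrite mem_cat XX ?orbT.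
- case/andP=> fp fq sRs; apply: def_or; [apply: IHp|apply: IHq] => //;
    by move=> X XX; apply: sRs; rewrite mem_cat XX ?orbT.
- case/andP=> fp fq sRs; apply: def_imp; [apply: IHp|apply: IHq] => //;
    by move=> X XX; apply: sRs; rewrite mem_cat XX ?orbT.
- by move=> fp sRs; apply: (def_all x (IH _ _)).
- by move=> fp sRs; apply: (def_ex x (IH _ _)).
Qed.

(** The set defined by [p] with parameters [w]: the tuple occupies the first [n] variables and the
    parameters follow. *)
Definition section n M (W : assignment2 M) (p : formula) (w : assignment1 M) :
  set (n.-tuple (carrier M)) := fun t => sat (scat t w) W p.

Definition sections M (W : assignment2 M) (E : relvar -> formula)
  (w : assignment1 M) : assignment2 M := fun X => section W (E X) w.

(* Substitution of definable sets for the relation variables of p. *)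
Lemma def_sections Rs p (E : relvar -> formula) :
    first_order p -> (forall X, core Rs (E X)) ->
  def Rs (fun M W v => sat (evens v) (sections W E (odds v)) p).
Proof.
move=> fp cE; have [q cq pq] := def_fo fp (fun X Xp => Xp).
suff dq : def Rs (fun M W v => sat (evens v) (sections W E (odds v)) q).
  by apply: def_ext dq => M W v; rewrite pq.
elim: cq {pq} => [x y|x y|X xs _|{}q _ IH|{}q r _ IHq _ IHr|x {}q _ IH] /=.
- by exists (Eq1 x.*2 y.*2) => //; constructor.
- by exists (Prec x.*2 y.*2) => //; constructor.
- apply: def_ext (core_comp (cE X) (scat (map double xs) (fun j => j.*2.+1))).
  by move=> M W v; rewrite comp_scat -map_comp.
- exact: def_not.
- exact: def_and.
apply: def_ext (def_ex x.*2 IH) => M W v.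
by split=> -[a pa]; exists a; move: pa; rewrite evens_dfwith odds_dfwith.
Qed.

(** * Least elements of definable sets and definable choice *)

Record wellord (Rs : seq relvar) (M : henkin) (W : assignment2 M) : Prop := {
  wellord_antisym : forall a b : carrier M, prec a b -> prec b a -> a = b;
  wellord_least : forall P, def Rs P -> forall v z,
    (exists b, P M W (dfwith v (i := z) b)) ->
    exists b, P M W (dfwith v (i := z) b) /\
      forall c, P M W (dfwith v (i := z) c) -> prec b c
}.

(** The induction fixes the tail [zs] in terms of [z]; then [z] is minimised among the values that
    admit a tail. This selects the lexicographically least tuple, by one formula for all
    structures. *)
Lemma skolem Rs P zs : uniq zs -> def Rs P -> exists2 P', def Rs P' &
  forall M W, wellord Rs W ->
  [/\ forall v, P' M W v -> P M W v,
      forall v, (exists2 u, agree_off zs u v & P M W u) ->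
        exists2 u, agree_off zs u v & P' M W u
    & forall u v, agree_off zs u v -> P' M W u -> P' M W v -> u = v].
Proof.
elim: zs => [_|z zs IH /= /andP[zzs uzs]] dP.
  exists P => // M W _; split=> // u v uv _ _.
  by apply: funext => y; apply: uv.
have {IH uzs dP}[P1 dP1 P1P] := IH uzs dP.
pose B : upred := fun M W v => exists2 u, agree_off zs u v & P1 M W u.
exists (fun M W v => P1 M W v /\
  (B M W v /\ forall b, B M W (dfwith v (i := z) b) -> prec (v z) b)).
  exact/(def_and dP1)/def_min/def_exs.
move=> M W wo; have {P1P}[sub ex uniqP] := P1P M W wo.
have zuv (u v : assignment1 M) b : agree_off zs u (dfwith v (i := z) b) -> u z = b.
  by move=> -> //; rewrite dfwith_in.
split=> [v [/sub //]|v [u /agree_off_cons uv Pu]|u v /agree_off_cons uv].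
  have Bv : exists b, B M W (dfwith v (i := z) b).
    by exists (u z); apply: ex; exists u.
  have [b [[u' u'v P1u'] minb]] := wellord_least wo (def_exs zs dP1) Bv.
  have u'z := zuv _ _ _ u'v.
  exists u'; first by apply/agree_off_cons; rewrite u'z.
  split=> //; split=> [|c [u2 u2u' P1u2]]; first by exists u'.
  rewrite u'z; apply: minb; exists u2 => // y yzs; rewrite u2u' //.
  have [<-|ne] := eqVneq z y; first by rewrite !dfwith_in.
  by rewrite !dfwith_out // u'v // dfwith_out.
move=> [P1u [_ minu]] [P1v [_ minv]].
have vu : agree_off zs v (dfwith u (i := z) (v z)).
  move=> y yzs; have [<-|ne] := eqVneq z y; first by rewrite dfwith_in.
  by rewrite dfwith_out // uv // dfwith_out.
have uzv : u z = v z.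
  apply: (wellord_antisym wo); first by apply: minu; exists v.
  by apply: minv; exists u.
by apply: uniqP => //; rewrite uzv dfwith_self in uv.
Qed.

(* By saturation finitely many defining formulas C n suffice; the least n and
   the lexicographically least parameters z make the choice definable. *)
Lemma definable_choice Rs (P : nat -> upred) (C : nat -> formula) m N :
    (forall n, def Rs (P n)) -> (forall n, core Rs (C n)) ->
  exists2 D, def Rs D & forall M W, wellord Rs W -> forall v,
  (exists2 n, n < N & exists z, P n M W (mix v z)) ->
  exists n z, P n M W (mix v z) /\ forall t, size t = m ->
    (D M W (scat t v) <-> sat (scat t z) W (C n)).
Proof.
move=> dP cC; elim: N => [|N [D dD hD]].
  by exists (fun _ _ _ => False) => [|M W _ v [] //]; apply: def_False.
pose E : upred := fun M W v => exists2 n, n < N & exists z, P n M W (mix v z).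
have dE : def Rs E by apply: def_bigor => n; apply: def_ex_odds.
have [p cp Pp] := dP N.
pose zs := [seq y <- undup (fv1 p) | odd y].
have uzs : uniq zs by rewrite filter_uniq ?undup_uniq.
have [P' dP' hP'] := skolem uzs (dP N).
(* When the even stream is [scat t v], [f] drops the [m] entries of [t], and [g] puts [t] in front
   of the odd stream, which holds the parameters. *)
pose f := mix (fun j => (m + j).*2) (fun j => j.*2.+1).
pose g := scat (map double (iota 0 m)) (fun j => j.*2.+1).
have d1 := def_exs zs (def_and (def_comp f dP') (core_comp (cC N) g)).
have {}d1 := def_comp (mix id (addn m)) d1.
have dEm := def_comp (addn m) dE.
(* If an index below [N] works, [D] decides; otherwise [C N] is used with its least parameters. *)
eexists; first exact: def_or (def_and dEm dD) (def_and (def_not dEm) d1).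
move=> M W wo v; cbv beta => vN; have {}hP' := hP' M W wo.
have scatm t : size t = m -> scat t v \o addn m = v.
  by move=> <-; apply: funext => j; apply: scat_addn.
have [Ev|nEv] := pselect (E M W v).
  have [n [z [Pz Dz]]] := hD M W wo v Ev; exists n, z; split=> // t tm.
  by rewrite scatm // -Dz //; tauto.
have [sub ex uniqP] := hP'.
have [z Pz] : exists z, P N M W (mix v z).
  case: vN => n; rewrite ltnS leq_eqVlt => /predU1P[-> //|nN Pn].
  by case: nEv; exists n.
(* Outside [zs] the odd positions repeat [v]; fixing them makes the parameter stream unique. *)
have [u uv P'u] : exists2 u, agree_off zs u (mix v v) & P' M W u.
  apply: ex; exists (fun y => if y \in zs then mix v z y else mix v v y).
    by move=> y /negPf ->.
  move/Pp: Pz => pz; apply/Pp; apply: (iffLR (sat_ext _ _)) pz => // y yp.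
  by rewrite mem_filter mem_undup yp andbT /mix; case: odd.
have uE : mix v (odds u) = u.
  rewrite -[RHS]mix_evens_odds; congr mix; apply: funext => j.
  by rewrite /evens uv /mix /= ?odd_double ?doubleK // mem_filter odd_double.
exists N, (odds u); split=> [|t tm]; first by rewrite uE; apply: sub.
have fE u1 : u1 \o f = mix (evens u1 \o addn m) (odds u1).
  by rewrite comp_mix.
have gE u1 : u1 \o g = scat (map (evens u1) (iota 0 m)) (odds u1).
  by rewrite comp_scat -map_comp.
rewrite scatm //; split=> [[[//]|[_ [u1 u1v]]]|Cu].
  have {}u1v : agree_off zs u1 (mix (scat t v) v).
    by move: u1v; rewrite comp_mix scatm.
  have u1e : evens u1 = scat t v.
    apply: funext => j.
    by rewrite /evens u1v /mix /= ?odd_double ?doubleK // mem_filter odd_double.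
  rewrite fE gE u1e scatm // map_scat // => -[P'u1].
  suff <- : mix v (odds u1) = u by rewrite odds_mix.
  apply: uniqP => // y yzs; rewrite uv // /mix.
  by case: ifP => // oy; rewrite odds_half // u1v // /mix oy.
right; split=> //; exists (mix (scat t v) (odds u)).
  rewrite comp_mix scatm // => y yzs; rewrite /mix; case: ifP => // oy.
  by rewrite odds_half // uv // /mix oy.
by rewrite fE gE evens_mix odds_mix scatm // uE map_scat.
Qed.

(** * Replacing relation variables by definable sets *)

Lemma scat_comp_upd A n (t : seq A) (v w : nat -> A) xs : n <= size t ->
  scat t (mix v w) \o mix (upd (fun j => size t + j.*2) xs (iota 0 n))
                          (fun j => size t + j.*2.+1)
  = mix (upd v xs (take n t)) w.
Proof.
move=> nt; rewrite comp_mix comp_upd; congr mix.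
  congr upd.
    by apply: funext => j /=; rewrite scat_addn -[LHS]/(evens _ j) evens_mix.
  by rewrite -{1}(cat_take_drop n t) scat_cat map_scat // size_takel.
by apply: funext => j /=; rewrite scat_addn -[LHS]/(odds _ j) odds_mix.
Qed.

(** Serves to merge parameter streams: a definition reads its own stream through [f] while the tuple
    stays in place. *)
Lemma section_comp Rs n p (f : nat -> nat) : core Rs p ->
  exists2 q, core Rs q & forall M (W : assignment2 M) w,
    section (n := n) W q w = section W p (w \o f).
Proof.
move=> cp; have [q cq qE] := core_comp cp (scat (iota 0 n) (addn n \o f)).
exists q => // M W w; apply/seteqP; split=> t; rewrite /section -qE comp_scat;
  rewrite map_scat ?size_tuple // compA;
  rewrite (_ : scat t w \o addn n = w) //;
  by apply: funext => j /=; have := scat_addn t w j; rewrite size_tuple.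
Qed.

(* At v = mix (mix u w) z: p holds at u, with the variables in Xs read as the
   sets defined by c from z and the others as the sets defined by E from w. *)
Definition witnessed (E c : relvar -> formula) (Xs : seq relvar) (p : formula)
  : upred := fun M W v =>
  sat (evens (evens v))
    (fun X => if X \in Xs then section W (c X) (odds v)
              else section W (E X) (odds (evens v))) p.

Lemma def_witnessed Rs E c Xs p :
    first_order p -> (forall X, core Rs (E X)) -> (forall X, core Rs (c X)) ->
  def Rs (witnessed E c Xs p).
Proof.
move=> fp cE cc.
have /choice[E' E'P] : forall X, exists q, core Rs q /\
    forall M (W : assignment2 M) w, section (n := arity X) W q w =
    if X \in Xs then section W (c X) (odds w) else section W (E X) (evens w).
  move=> X; case: (X \in Xs).
    by have [q cq qE] := section_comp (arity X) (fun j => j.*2.+1) (cc X); exists q.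
  by have [q cq qE] := section_comp (arity X) double (cE X); exists q.
have cE' X : core Rs (E' X) by case: (E'P X).
(* For [v = mix (mix u w) z], [f] makes [u] the even stream and interleaves the parameters [w] and
   [z] in the odd one. *)
pose f := mix (fun j => j.*2.*2) (mix (fun j => j.*2.+1.*2) (fun j => j.*2.+1)).
apply: def_ext (def_comp f (def_sections fp cE')) => M W v.
rewrite /witnessed.
have -> : evens (v \o f) = evens (evens v) by rewrite comp_mix evens_mix.
have -> : odds (v \o f) = mix (odds (evens v)) (odds v).
  by rewrite comp_mix odds_mix comp_mix.
suff -> : sections W E' (mix (odds (evens v)) (odds v)) =
    fun X => if X \in Xs then section W (c X) (odds v)
             else section W (E X) (odds (evens v)) by [].
apply: functional_extensionality_dep => X.
by rewrite /sections (proj2 (E'P X)) odds_mix evens_mix.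
Qed.

Lemma witnessed_sat Rs M (W : assignment2 M) E c Xs p u w z :
    (forall n q w', core Rs q -> rels M n (section W q w')) ->
    (forall X, core Rs (E X)) -> (forall X, core Rs (c X)) ->
  witnessed E c Xs p W (mix (mix u w) z) ->
  sat u (sections W E w) (Ex2s Xs p).
Proof.
move=> relsW cE cc; rewrite /witnessed !evens_mix !odds_mix => pu.
apply/sat_Ex2s; first by move=> X; apply: relsW.
eexists; split; last exact: pu.
  by move=> X /negPf ->.
by move=> X; case: ifP => _; apply: relsW.
Qed.

(** * Enumeration of the defining formulas *)

Fixpoint decode (t : GenTree.tree (seq nat)) : formula :=
  match t with
  | GenTree.Leaf (0 :: x :: y :: _) => Eq1 x y
  | GenTree.Leaf (1 :: x :: y :: _) => Prec x y
  | GenTree.Leaf (_ :: n :: i :: xs) =>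
      if insub xs is Some xs' then @Rel (n, i) xs' else Eq1 0 0
  | GenTree.Node 0 [:: t1] => Not (decode t1)
  | GenTree.Node 1 [:: t1; t2] => And (decode t1) (decode t2)
  | GenTree.Node x.+2 [:: t1] => Ex1 x (decode t1)
  | _ => Eq1 0 0
  end.

(** Core formulas are thus countable, since [GenTree.tree (seq nat)] is a countable type. *)
Lemma decode_onto Rs p : core Rs p -> exists t, decode t = p.
Proof.
elim=> {p} [x y|x y|[n i] xs _|p _ [t <-]|p q _ [t <-] _ [t' <-]|x p _ [t <-]].
- by exists (GenTree.Leaf [:: 0; x; y]).
- by exists (GenTree.Leaf [:: 1; x; y]).
- by exists (GenTree.Leaf [:: 2, n, i & xs]); rewrite /= valK.
- by exists (GenTree.Node 0 [:: t]).
- by exists (GenTree.Node 1 [:: t; t']).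
- by exists (GenTree.Node x.+2 [:: t]).
Qed.

(** The functions [g] are uncountably many; a sequence can match them only on finite lists [Xs]. *)
Definition enumerates (Rs : seq relvar) (e : nat -> relvar -> formula) :=
  (forall n X, core Rs (e n X)) /\
  forall g : relvar -> formula, (forall X, core Rs (g X)) ->
  forall Xs : seq relvar, exists n, forall X, X \in Xs -> e n X = g X.

Lemma ex_enumerates Rs : exists e, enumerates Rs e.
Proof.
pose d0 := GenTree.Leaf [:: 0; 0; 0].
(* [n] codes a list of trees in which [X] looks up entry [pickle X]; anything that is not a core
   formula over [Rs] becomes [Eq1 0 0]. *)
pose F (n : nat) (X : relvar) : formula :=
  let s := odflt [::] (unpickle n : option (seq (GenTree.tree (seq nat)))) in
  let p := decode (nth d0 s (pickle X)) in
  if pselect (core Rs p) then p else Eq1 0 0.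
exists F; split=> [n X|g cg Xs].
  by rewrite /F /=; case: pselect => //= b; constructor.
have /choice[t tP] : forall X, exists t, decode t = g X.
  by move=> X; apply: decode_onto (cg X).
pose K := (\max_(X <- Xs) pickle X).+1.
pose s := [seq if unpickle k is Some X then t X else d0 | k <- iota 0 K].
exists (pickle s) => X XXs; rewrite /F pickleK /=.
have -> : nth d0 s (pickle X) = t X.
  have XK : pickle X < K by rewrite ltnS (leq_bigmax_seq X).
  by rewrite (nth_map 0) ?size_iota // nth_iota // add0n pickleK.
by rewrite tP; case: pselect => // -[]; apply: cg.
Qed.

(** Countable saturation as compactness: by complements, a countable type in the variables [xs] with
    parameters from [v] is realised once it is finitely satisfiable. *)
Definition saturated (Rs : seq relvar) (M : henkin) (W : assignment2 M) :=
  forall P : nat -> upred, (forall n, def Rs (P n)) -> forall xs v,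
  (forall u, agree_off xs u v -> exists n, P n M W u) ->
  exists N, forall u, agree_off xs u v -> exists2 n, n < N & P n M W u.

Definition rels_definable (Rs : seq relvar) (M : henkin) (W : assignment2 M) :=
  forall n R, rels M n R <-> exists p w, core Rs p /\ R = section W p w.

Lemma prec_least_axE (M : henkin) : valid_in M prec_least_ax <->
  forall R, rels M 0 R -> (exists a, R [tuple a]) ->
  exists b, R [tuple b] /\ forall c, R [tuple c] -> prec b c.
Proof.
pose mem x : formula := @Rel (0, 0) [tuple x].
have memE (V : assignment2 M) R (u : assignment1 M) x :
    sat u (dfwith V (i := (0, 0)) R) (mem x) <-> R [tuple u x].
  rewrite /= dfwith_in; set t := [tuple of _]; set t' := [tuple of _].
  by have -> : t = t' by apply: val_inj.
have sat_least (v : assignment1 M) V : sat v V prec_least_ax <->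
    forall R, rels M 0 R -> let V' := dfwith V (i := (0, 0)) R in
  (exists a, sat (dfwith v (i := 0) a) V' (mem 0)) ->
  exists b, sat (dfwith v (i := 0) b) V' (mem 0) /\ forall c,
    sat (dfwith (dfwith v (i := 0) b) (i := 1) c) V' (mem 1) ->
    prec (dfwith (dfwith v (i := 0) b) (i := 1) c 0)
         (dfwith (dfwith v (i := 0) b) (i := 1) c 1) by [].
split=> [Ml R RM [a Ra]|least v V _].
  have [V fV] := ex_full M.
  have {Ml} := iffLR (sat_least _ _) (Ml (fun=> a) V fV) R RM; cbv zeta.
  case=> [|b [/memE Rb minb]]; first by exists a; apply/memE; rewrite dfwith_in.
  rewrite dfwith_in in Rb; exists b; split=> // c Rc; have := minb c.
  rewrite [X in prec X]dfwith_out // !dfwith_in; apply.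
  by apply/memE; rewrite dfwith_in.
apply/sat_least => R RM V' [a /memE]; rewrite dfwith_in => Ra.
have [b [Rb minb]] := least R RM (ex_intro _ a Ra).
exists b; split; first by apply/memE; rewrite dfwith_in.
move=> c /memE; rewrite dfwith_in => Rc.
by rewrite [X in prec X]dfwith_out // !dfwith_in; apply: minb.
Qed.

(** * Saturated structures with their definable sets *)

Section DefinableSets.
Variables (Rs : seq relvar) (M : henkin) (W : assignment2 M).
Hypothesis relsM : rels_definable Rs W.

Lemma rels_section n p w : core Rs p -> rels M n (section W p w).
Proof. by move=> cp; apply/relsM; exists p, w. Qed.

(** The parameter streams, one for each relation variable, are merged into one by coding the pair
    [(X, i)] as a position. *)
Lemma full_sections V : full V ->
  exists E w, (forall X, core Rs (E X)) /\ V = sections W E w.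
Proof.
move=> fV.
have /choice[p_ /choice[w_ pw]] : forall X, exists p w, core Rs p /\
  V X = section W p w by move=> X; apply/relsM.
pose w j := if unpickle j is Some (X, i) then w_ X i else w_ (0, 0) 0.
have /choice[E EP] : forall X, exists q, core Rs q /\
    forall M (W : assignment2 M) w, section (n := arity X) W q w =
      section W (p_ X) (w \o (fun i => pickle (X, i))).
  by move=> X; have [q cq qE] := section_comp (arity X)
    (fun i => pickle (X, i)) (proj1 (pw X)); exists q.
exists E, w; split=> [X|]; first by case: (EP X).
apply: functional_extensionality_dep => X.
rewrite /sections (proj2 (EP X)) (proj2 (pw X)); congr section.
by apply: funext => i /=; rewrite /w pickleK.
Qed.

(** Witnesses are definable because all relations of [M] are; as [Xs] is finite, one index of the
    enumeration captures their definitions. *)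
Lemma sat_witnessed e E Xs p u w : enumerates Rs e -> first_order p ->
    (forall X, core Rs (E X)) -> sat u (sections W E w) (Ex2s Xs p) ->
  exists n z, witnessed E (e n) Xs p W (mix (mix u w) z).
Proof.
move=> [_ eP] fp cE.
have fE : full (sections W E w) by move=> X; apply: rels_section.
move=> /(sat_Ex2s _ _ _ fE)[V [VE fV pu]].
have [c [z [cc Vc]]] := full_sections fV.
have [n en] := eP c cc Xs; exists n, z.
rewrite /witnessed !evens_mix !odds_mix.
apply: (iffLR (sat_ext _ _)) pu => // X _.
case: ifPn => XXs; first by rewrite en // Vc.
by rewrite VE.
Qed.

Hypothesis woW : wellord Rs W.

Lemma prec_least_valid : valid_in M prec_least_ax.
Proof.
apply/prec_least_axE => R /relsM[p [w [cp RE]]] [a Ra].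
pose P : upred := fun M W v => sat v W p.
have dP : def Rs P by exists p.
have PE b : P M W (dfwith (scat [:: a] w) (i := 0) b) <-> R [tuple b].
  rewrite RE /section /P; suff -> : dfwith (scat [:: a] w) (i := 0) b =
    scat [tuple b] w by [].
  by apply: funext => -[|j]; rewrite ?dfwith_in // dfwith_out.
have [b [Rb minb]] : exists b, P M W (dfwith (scat [:: a] w) (i := 0) b) /\
    forall c, P M W (dfwith (scat [:: a] w) (i := 0) c) -> prec b c.
  by apply: (wellord_least woW dP); exists a; apply/PE.
by exists b; split=> [|c Rc]; [apply/PE | apply/minb/PE].
Qed.

Lemma extensionality_valid n : valid_in M (extensionality_ax n).
Proof.
move=> v V _; rewrite /extensionality_ax.
set xs := [tuple of _]; have uxs : uniq xs by apply: iota_uniq.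
clearbody xs => R1 R1M R2 R2M.
set V' := dfwith _ _; move=> /sat_All1s h.
apply/seteqP; split=> t Vt;
  by have := h (upd v xs t) (upd_agree v _);
    rewrite !size_tuple => /(_ erefl); rewrite /= tuple_map_upd //; tauto.
Qed.

Lemma rels_comp n P (f : nat -> nat) (w : assignment1 M) : def Rs P ->
  rels M n (fun t => P M W (scat t w \o f)).
Proof.
case=> p cp Pp; have [q cq qE] := core_comp cp f.
apply/relsM; exists q, w; split=> //.
by apply: funext => t; apply: propext; rewrite /section -qE Pp.
Qed.

Lemma comprehension_valid X (xs : (arity X).-tuple nat) p :
    uniq xs -> first_order p -> X \notin fv2 p ->
  valid_in M (comprehension_ax xs p).
Proof.
move=> uxs fp Xp v V /full_sections[E [w [cE VE]]] /=.
pose R : set ((arity X).-tuple (carrier M)) := fun t => sat (upd v xs t) V p.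
exists R.
  (* The tuple fills the first [arity X] positions; behind it [v] sits at even and [w] at odd
     offsets. *)
  have := rels_comp X.1 (mix (upd (fun j => arity X + j.*2) xs (iota 0 (arity X)))
    (fun j => arity X + j.*2.+1)) (mix v w) (def_sections fp cE).
  congr (rels M X.1 _); apply: funext => t; rewrite /R VE.
  have := scat_comp_upd v w xs (leqnn (size t)).
  rewrite [size t]size_tuple => ->.
  by rewrite evens_mix odds_mix take_oversize // size_tuple.
apply/sat_All1s => u uv.
have RE : R [tuple of map u xs] <-> sat u (dfwith V (i := X) R) p.
  rewrite /R /= -agree_upd //; apply: sat_ext => // Y Yp.
  by rewrite dfwith_out //; apply: contraNneq Xp => ->.
by move: RE; rewrite /= dfwith_in; tauto.
Qed.

Hypothesis satW : saturated Rs W.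

Lemma choice_valid k (xs : k.+1.-tuple nat) X j (ys : (arity X).-tuple nat) p :
    uniq (xs ++ ys) -> sigma11 p -> choice_var k X j \notin fv2 p ->
  valid_in M (choice_ax xs j ys p).
Proof.
rewrite cat_uniq => /and3P[uxs /hasPn xsys uys] /sigma11_Ex2s[Xs [p0 [fp0 pE]]] cvp.
move=> v V fV; have [E [w [cE VE]]] := full_sections fV.
have [e ee] := ex_enumerates Rs; have ce := proj1 ee.
(* [X] joins the prefix [Xs]: the [n]-th choice of definitions must provide both the chosen set and
   the witnesses of [p]. *)
pose P n := witnessed E (e n) (X :: Xs) p0.
have dP n : def Rs (P n) by apply: def_witnessed.
move=> /sat_All1s hyp.
have {}hyp u : agree_off xs u v -> exists n z, P n M W (mix (mix u w) z).
  by move=> /hyp; rewrite VE pE => /(@sat_witnessed e E (X :: Xs) p0 u w ee fp0 cE).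
have [N hN] : exists N, forall u, agree_off xs u v ->
    exists2 n, n < N & exists z, P n M W (mix (mix u w) z).
  (* In [mix v w] the variables [xs] become [map double xs], and the parameters [w] stay fixed. *)
  have [u uv|N hN] := satW (fun n => def_ex_odds (dP n))
    (xs := map double xs) (v := mix v w).
    have uE : u = mix (evens u) w.
      rewrite -[LHS]mix_evens_odds; congr mix; apply: funext => i.
      rewrite /odds uv; first by rewrite -[LHS]/(odds _ i) odds_mix.
      by apply/mapP => -[y _] /(congr1 odd); rewrite /= !odd_double.
    rewrite uE; apply: hyp => y yxs; rewrite /evens uv; last first.
      by rewrite (mem_map double_inj).
    by rewrite -[LHS]/(evens _ y) evens_mix.
  exists N => u uv; apply: hN => y yxs; rewrite /mix; case: ifPn => // /negPf ey.
  apply: uv; apply: contra yxs => yxs; apply/mapP; exists y./2 => //.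
  by rewrite -[LHS]odd_double_half ey.
have [D dD hD] := definable_choice (arity X) N dP (fun n => ce n X).
(* The first [k.+1] coordinates are values of [xs]; the others are tested for membership in the set
   that [D] selects there. *)
pose R : set ((arity (choice_var k X j)).-tuple (carrier M)) := fun t =>
  D M W (scat (drop k.+1 t) (mix (upd v xs (take k.+1 t)) w)).
have RM : rels M (k + arity X) R.
  pose K := k.+1 + arity X.
  have := rels_comp (k + arity X) (scat (iota k.+1 (arity X))
    (mix (upd (fun i => K + i.*2) xs (iota 0 k.+1)) (fun i => K + i.*2.+1)))
    (mix v w) dD.
  congr (rels M _ _); apply: funext => t; rewrite /R.
  have tK : size t = K by rewrite size_tuple.
  have kt : k.+1 <= size t by rewrite tK leq_addr.
  have := scat_comp_upd v w xs kt; rewrite comp_scat tK => ->.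
  congr (D M W (scat _ _)); rewrite -[in LHS](cat_take_drop k.+1 t) scat_cat.
  rewrite map_scat_addn ?size_takel // map_scat // size_drop tK.
  by rewrite addKn.
exists R => //; apply/sat_All1s => u uv.
have [n [z [Pz Dz]]] := hD M W woW _ (hN u uv).
exists (section W (e n X) z); first by apply: rels_section.
(* The arity of the choice variable exceeds that of [X] by [k.+1]. *)
have Xcv : choice_var k X j != X.
  apply/eqP => /(congr1 fst) /= /eqP.
  by rewrite /arity addnS -[X in _ == X]add0n -addSn eqn_add2r.
split.
  apply/sat_All1s => u' u'u.
  have xs_u : map u' xs = map u xs.
    apply/eq_in_map => y yxs; apply: u'u; apply: contraL yxs; exact: xsys.
  have Rsec : R [tuple of map u' (xs ++ ys)] <->
      section W (e n X) z [tuple of map u' ys].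
    rewrite /R /section -Dz ?size_map ?size_tuple //= map_cat.
    rewrite take_size_cat ?drop_size_cat ?size_map ?size_tuple //.
    by rewrite xs_u -agree_upd.
  move: Rsec; rewrite /= dfwith_in dfwith_out 1?eq_sym // dfwith_in; tauto.
have fX : rels M X.1 (section W (e n X) z) by apply: rels_section.
suff : sat u (dfwith V (i := X) (section W (e n X) z)) p.
  apply: (iffLR (sat_ext _ _)) => // Y Yp.
  have [<-|ne] := eqVneq X Y; first by rewrite !dfwith_in.
  by rewrite !dfwith_out //; apply: contraNneq cvp => ->.
rewrite pE; apply/sat_Ex2s; first exact: full_dfwith.
move: Pz; rewrite /P /witnessed !evens_mix !odds_mix => Pz.
eexists; split; last exact: Pz.
  move=> Y YXs; rewrite inE (negPf YXs) orbF; have [->|ne] := eqVneq Y X.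
    by rewrite dfwith_in.
  by rewrite dfwith_out 1?eq_sym // VE.
by move=> Y; case: ifP => _; apply: rels_section.
Qed.

Hypothesis orderM : [/\ valid_in M prec_refl_ax, valid_in M prec_antisym_ax,
  valid_in M prec_trans_ax & valid_in M prec_linear_ax].

Theorem definable_model : is_model sigma11_AC0_wo M.
Proof.
case: orderM => Mrefl Mantisym Mtrans Mlinear.
move=> p [n|X xs q uxs fq Xq|k xs X j ys q uxy sq cq| | | | |] //.
- exact: extensionality_valid.
- exact: comprehension_valid.
- exact: choice_valid.
- exact: prec_least_valid.
Qed.

End DefinableSets.

(** * Ultraproducts *)

Lemma model_definable_set M (W : assignment2 M) Rs P n (xs : n.+1.-tuple nat) v :
    is_model sigma11_AC0_wo M -> full W -> def Rs P -> uniq xs ->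
  exists2 R, rels M n R & forall u, agree_off xs u v ->
    R [tuple of map u xs] <-> P M W u.
Proof.
move=> TM fW [p cp Pp] uxs.
(* An index above all those in [Rs] gives a fresh variable for comprehension. *)
pose X : relvar := (n, (\max_(Y <- Rs) Y.2).+1).
have XRs : X \notin Rs.
  apply/negP => XRs; suff : X.2 <= \max_(Y <- Rs) Y.2 by rewrite /= ltnn.
  by rewrite (leq_bigmax_seq X).
have Xp : X \notin fv2 p by apply: contra XRs; apply: core_fv2.
have [R RM /sat_All1s Rp] := TM _ (ax_comprehension (X := X) uxs
  (core_first_order cp) Xp) v W fW.
exists R => // u uv; rewrite Pp.
have -> : sat u W p <-> sat u (dfwith W (i := X) R) p.
  apply: sat_ext => // Y Yp; rewrite dfwith_out //.
  by apply: contraNneq Xp => ->.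
by have := Rp u uv; rewrite /= dfwith_in; tauto.
Qed.

Lemma model_section M (W : assignment2 M) Rs n p w :
    is_model sigma11_AC0_wo M -> full W -> core Rs p ->
  rels M n (section W p w).
Proof.
move=> TM fW cp; pose xs : n.+1.-tuple nat := [tuple of iota 0 n.+1].
have uxs : uniq xs by apply: iota_uniq.
(* The shift by [n.+1] puts the parameters behind the tuple, as in [scat]. *)
have [R RM RE] := model_definable_set (fun j => w (j - n.+1)) TM fW
  (def_sat cp) uxs.
suff <- : R = section W p w by [].
apply: funext => t; apply: propext.
have tE : [tuple of map (scat t w) xs] = t.
  by apply: val_inj; apply: map_scat; rewrite size_tuple.
rewrite -[in R _]tE RE // => y yxs; rewrite /scat nth_default ?size_tuple //.
by move: yxs; rewrite mem_iota add0n /= -leqNgt.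
Qed.

Lemma model_least M (W : assignment2 M) Rs P v z :
    is_model sigma11_AC0_wo M -> full W -> def Rs P ->
    (exists b, P M W (dfwith v (i := z) b)) ->
  exists b, P M W (dfwith v (i := z) b) /\
    forall c, P M W (dfwith v (i := z) c) -> prec b c.
Proof.
move=> TM fW dP [a Pa].
have [R RM RE] := model_definable_set v TM fW dP (isT : uniq [tuple z]).
have {}RE b : R [tuple b] <-> P M W (dfwith v (i := z) b).
  rewrite -RE; last by move=> y; rewrite inE => yz; rewrite dfwith_out // eq_sym.
  suff -> : [tuple of map (dfwith v (i := z) b) [tuple z]] = [tuple b] by [].
  by apply: val_inj; rewrite /= dfwith_in.
have [|b [/RE Pb minb]] := iffLR (prec_least_axE M) (TM _ ax_prec_least) R RM.
  by exists a; apply/RE.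
by exists b; split=> // c /RE /minb.
Qed.

Lemma antisym_of_ax (M : henkin) : valid_in M prec_antisym_ax ->
  forall a b : carrier M, prec a b -> prec b a -> a = b.
Proof.
have [V fV] := ex_full M.
move=> ax a b ab ba; have /= := ax (fun=> a) V fV a b.
by rewrite !dfwith_in dfwith_out // dfwith_in; apply.
Qed.

Section Ultraproduct.
Local Open Scope classical_set_scope.
Variables (U : set_system nat) (UU : UltraFilter U).
Variables (Rs : seq relvar) (M : nat -> henkin).
Variable W : forall i, assignment2 (M i).

Lemma ultra_not (A : nat -> Prop) : U [set i | ~ A i] <-> ~ U [set i | A i].
Proof.
split=> [nA UA|]; last by have [//|] := in_ultra_setVsetC [set i | A i] UU.
apply: (filter_not_empty U); apply: filterS (filterI UA nA) => i [Ai] /=.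
exact.
Qed.

Lemma ultra_iff (A B : nat -> Prop) : U [set i | A i <-> B i] ->
  U [set i | A i] <-> U [set i | B i].
Proof.
move=> AB; split=> UA; apply: filterS (filterI AB UA) => i [[]]; tauto.
Qed.

Lemma ultra_and (A B : nat -> Prop) :
  U [set i | A i /\ B i] <-> U [set i | A i] /\ U [set i | B i].
Proof.
split=> [AB|[UA UB]]; last exact: filterI.
by split; apply: filterS AB => i [].
Qed.

Lemma ultra_all_in (A : nat -> nat -> Prop) (xs : seq nat) :
  (forall y, U [set i | A y i]) -> U [set i | forall y, y \in xs -> A y i].
Proof.
move=> UA; elim: xs => [|x xs IH].
  by apply: filterS filterT => i _ y; rewrite in_nil.
apply: filterS (filterI (UA x) IH) => i [Ax Axs] y.
by rewrite inE => /predU1P[->|/Axs].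
Qed.

Definition uclass (f : forall i, carrier (M i)) : set (forall i, carrier (M i)) :=
  [set g | U [set i | f i = g i]].

Definition ucarrier := {S | exists f, S = uclass f}.

Definition ucls f : ucarrier := exist _ (uclass f) (ex_intro _ f erefl).

Definition urep (a : ucarrier) : forall i, carrier (M i) :=
  projT1 (cid (projT2 a)).

Lemma urepK a : ucls (urep a) = a.
Proof.
rewrite /ucls /urep; case: a => S Sf /=; case: cid => f /= Sf'.
by apply: eq_exist.
Qed.

Lemma ucls_eq f g : ucls f = ucls g <-> U [set i | f i = g i].
Proof.
split=> [/(congr1 sval) /= fg|fg].
  suff : uclass f g by [].
  by rewrite fg; apply: filterS filterT.
apply: eq_exist; apply/seteqP; split=> h fh;
  by apply: filterS (filterI fg fh) => i /= [-> ->].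
Qed.

Lemma ucls_urep f : U [set i | urep (ucls f) i = f i].
Proof. by apply/ucls_eq; rewrite urepK. Qed.

Definition uval (u : forall i, assignment1 (M i)) : nat -> ucarrier :=
  fun j => ucls (fun i => u i j).

Definition ucoord (v : nat -> ucarrier) i : assignment1 (M i) :=
  fun j => urep (v j) i.

Lemma ucoordK v : uval (ucoord v) = v.
Proof. by apply: funext => j; rewrite /uval urepK. Qed.

(* Only the internal sets that one formula p defines in all factors are kept. *)
Definition urels n : set (set (n.+1.-tuple ucarrier)) :=
  [set R | exists p w, core Rs p /\
    R = [set t : n.+1.-tuple ucarrier | U [set i | sat (ucoord (scat t w) i) (@W i) p]]].

Lemma ucarrier_neq0 : [set: ucarrier] !=set0.
Proof. by exists (ucls (fun i => projT1 (cid (carrier_neq0 (M i))))). Qed.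

Lemma urels_neq0 n : @urels n !=set0.
Proof.
have [a _] := ucarrier_neq0; eexists; exists (Eq1 0 0), (fun=> a).
by split; first by constructor.
Qed.

Definition ultraproduct : henkin := Henkin ucarrier_neq0
  (fun a b => U [set i | prec (urep a i) (urep b i)]) urels_neq0.

Definition urel : assignment2 ultraproduct := fun X t =>
  U [set i | @W i X [tuple of map (fun a => urep a i) t]].

(** Łoś's theorem. Negation uses that [U] is an ultrafilter; for the quantifier a witness is chosen
    in every factor that has one. *)
Lemma los p (u : forall i, assignment1 (M i)) : core Rs p ->
  @sat ultraproduct (uval u) urel p <-> U [set i | sat (u i) (@W i) p].
Proof.
move=> cp; elim: cp u => {p} [x y|x y|X xs _|p _ IH|p q _ IHp _ IHq|x p _ IH] u /=.
- exact: ucls_eq.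
- apply: ultra_iff; apply: filterS (filterI (ucls_urep (fun i => u i x))
    (ucls_urep (fun i => u i y))) => i [/= E1 E2].
  by rewrite -E1 -E2.
- apply: ultra_iff; have := ultra_all_in xs (fun y => ucls_urep (fun i => u i y)).
  apply: filterS => i E /=; set t := [tuple of _]; set t' := [tuple of _].
  suff -> : t = t' by [].
  apply: val_inj; rewrite /= -map_comp; apply/eq_in_map => y /E; exact.
- by rewrite IH ultra_not.
- by rewrite IHp IHq ultra_and.
split=> [[a]|Uex].
  have -> : dfwith (uval u) (i := x) a =
      uval (fun i => dfwith (u i) (i := x) (urep a i)).
    apply: funext => y; rewrite /uval; have [<-|ne] := eqVneq x y.
      rewrite dfwith_in -[LHS]urepK; congr ucls.
      by apply: functional_extensionality_dep => i; rewrite dfwith_in.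
    rewrite dfwith_out //; congr ucls.
    by apply: functional_extensionality_dep => i; rewrite dfwith_out.
  by move=> /IH; apply: filterS => i /= pa; exists (urep a i).
have wit i : exists a, (exists b, sat (dfwith (u i) (i := x) b) (@W i) p) ->
    sat (dfwith (u i) (i := x) a) (@W i) p.
  have [[a pa]|nex] := pselect (exists b, sat (dfwith (u i) (i := x) b) (@W i) p).
    by exists a.
  by exists (u i x).
pose f i := projT1 (cid (wit i)); exists (ucls f).
have -> : dfwith (uval u) (i := x) (ucls f) =
    uval (fun i => dfwith (u i) (i := x) (f i)).
  apply: funext => y; rewrite /uval; have [<-|ne] := eqVneq x y.
    rewrite dfwith_in; congr ucls.
    by apply: functional_extensionality_dep => i; rewrite dfwith_in.
  rewrite dfwith_out //; congr ucls.
  by apply: functional_extensionality_dep => i; rewrite dfwith_out.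
by apply/IH; apply: filterS Uex => i /= ex; apply: (projT2 (cid (wit i))).
Qed.

Lemma los_def P (u : forall i, assignment1 (M i)) : def Rs P ->
  P ultraproduct urel (uval u) <-> U [set i | P (M i) (@W i) (u i)].
Proof.
case=> p cp Pp; rewrite Pp los //.
by apply: ultra_iff; apply: filterS filterT => i _ /=; rewrite Pp.
Qed.

Lemma los_ucoord P v : def Rs P ->
  P ultraproduct urel v <-> U [set i | P (M i) (@W i) (ucoord v i)].
Proof. by move=> dP; rewrite -{1}(ucoordK v) los_def. Qed.

Lemma ultraproduct_rels : rels_definable Rs urel.
Proof.
have secE n p w : core Rs p -> section (n := n) urel p w =
    [set t : n.-tuple ucarrier | U [set i | sat (ucoord (scat t w) i) (@W i) p]].
  move=> cp; apply: funext => t; apply: propext.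
  by have := los (ucoord (scat t w)) cp; rewrite ucoordK.
by move=> n R; split=> -[p [w [cp ->]]]; exists p, w; split=> //; rewrite secE.
Qed.

Lemma ultraproduct_valid p : first_order p -> fv2 p = [::] ->
  (forall i, valid_in (M i) p) -> valid_in ultraproduct p.
Proof.
move=> fp p0 pM v V _.
have dp : def Rs (fun M W v => sat v W p) by apply: def_fo; rewrite ?p0.
suff : sat v urel p by apply: (iffLR (sat_ext _ _)) => // X; rewrite p0.
apply/(los_ucoord v dp); apply: filterS filterT => i _ /=.
have [V' fV'] := ex_full (M i).
by apply: (iffLR (sat_ext _ _)) (pM i _ V' fV') => // X; rewrite p0.
Qed.

Hypothesis cofiniteU : forall N, U [set i | N <= i].

(** A diagonal argument: were no [N] enough, one would choose in each factor [i] a point avoiding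
    the longest possible initial run of the first [i] predicates. The class of these points would
    satisfy no [P n], as [U] contains all final segments. *)
Lemma ultraproduct_saturated : saturated Rs urel.
Proof.
move=> P dP xs v cover; apply: contrapT => nN.
pose A N i := exists2 u : assignment1 (M i), agree_off xs u (ucoord v i) &
  ~ exists2 n, n < N & P n (M i) (@W i) u.
have UA N : U [set i | A N i].
  have [u uv nP] : exists2 u, agree_off xs u v &
      ~ exists2 n, n < N & P n ultraproduct urel u.
    apply: contrapT => nu; apply: nN; exists N => u uv.
    by apply: contrapT => nP; apply: nu; exists u.
  move/(los_ucoord u (def_not (def_bigor N dP))): nP.
  apply: filterS => i /= nP; exists (ucoord u i) => // y yxs.
  by rewrite /ucoord uv.
(* In factor i, u avoids P 0, ..., P N.-1 for the largest N <= K possible. *)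
have claim K i : exists2 u : assignment1 (M i), agree_off xs u (ucoord v i) &
    forall N, N <= K -> A N i -> ~ exists2 n, n < N & P n (M i) (@W i) u.
  elim: K => [|K [u uv uP]].
    exists (ucoord v i) => // N; rewrite leqn0 => /eqP -> _ [n] //.
  have [[u' u'v u'P]|nA] := pselect (A K.+1 i).
    exists u' => // N NK _ [n nN' Pn]; apply: u'P; exists n => //.
    exact: leq_trans NK.
  by exists u => // N; rewrite leq_eqVlt => /predU1P[->|/uP].
pose u i := projT1 (cid2 (claim i i)).
have uP i : agree_off xs (u i) (ucoord v i) /\
    forall N, N <= i -> A N i -> ~ exists2 n, n < N & P n (M i) (@W i) (u i).
  by rewrite /u; case: cid2.
have [n /los_def Pn] : exists n, P n ultraproduct urel (uval u).
  apply: cover => y yxs; rewrite -(ucoordK v) /uval; congr ucls.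
  by apply: functional_extensionality_dep => i; apply: (proj1 (uP i)).
(* In a factor [i > n] where the first [n.+1] predicates can be avoided together, [u i] was chosen
   to avoid them. *)
have [i [[Pi Ai] ni]] := filter_ex (filterI (filterI (Pn (dP n)) (UA n.+1))
  (cofiniteU n.+1)).
by apply: (proj2 (uP i)) ni Ai _; exists n.
Qed.

Hypothesis modelM : forall i, is_model sigma11_AC0_wo (M i).
Hypothesis fullW : forall i, full (@W i).

(** Well-ordering is not first-order, but the least element principle for a single definable [P] is,
    and so it transfers for each [P] separately. *)
Lemma ultraproduct_wellord : wellord Rs urel.
Proof.
split=> [|P dP v z].
  apply: antisym_of_ax; apply: ultraproduct_valid => // i.
  exact/modelM/ax_prec_antisym.
pose least : upred := fun M W v =>
  (exists b, P M W (dfwith v (i := z) b)) ->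
  exists b, P M W (dfwith v (i := z) b) /\ forall c,
    P M W (dfwith (dfwith v (i := z) b) (i := z) c) ->
    prec (dfwith v (i := z) b z) c.
have dleast : def Rs least.
  exact: def_imp (def_ex z dP) (def_ex z (def_min z dP)).
suff : least ultraproduct urel v.
  move=> lv /lv[b [Pb minb]]; exists b; split=> // c Pc.
  by move: (minb c); rewrite dfwith_in dfwithK; apply.
apply/(los_ucoord v dleast); apply: filterS filterT => i _ /= ex.
have [b [Pb minb]] := model_least (@modelM i) (@fullW i) dP ex.
by exists b; split=> // c; rewrite dfwith_in dfwithK; apply: minb.
Qed.

Theorem ultraproduct_model : is_model sigma11_AC0_wo ultraproduct.
Proof.
apply: (definable_model ultraproduct_rels ultraproduct_wellord
  ultraproduct_saturated).
by split; apply: ultraproduct_valid => // i; apply: modelM; constructor.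
Qed.

End Ultraproduct.

(** Variables of [Rs] define themselves; all others get the full relation as a default. *)
Definition base (Rs : seq relvar) (X : relvar) : formula :=
  if X \in Rs then @Rel X [tuple of iota 0 (arity X)] else Eq1 0 0.

Lemma core_base Rs X : core Rs (base Rs X).
Proof. by rewrite /base; case: ifP => XRs; constructor. Qed.

Lemma sections_base Rs M (W : assignment2 M) w X :
  X \in Rs -> (sections W (base Rs) w : assignment2 M) X = W X.
Proof.
move=> XRs; apply: funext => t; apply: propext.
rewrite /sections /base XRs /section.
suff -> : sat (scat t w) W (@Rel X [tuple of iota 0 (arity X)]) = W X t by [].
congr (W X _); apply: val_inj; apply: map_scat; by rewrite size_tuple.
Qed.

(** Comprehension puts the definable witnesses into any model, even one that has further
    relations. *)
Lemma witnessed_base_sat Rs M (W : assignment2 M) c Xs p u v :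
    is_model sigma11_AC0_wo M -> full W -> (forall X, core Rs (c X)) ->
    fv1 (Ex2s Xs p) = [::] -> {subset fv2 (Ex2s Xs p) <= Rs} ->
  witnessed (base Rs) c Xs p W u -> sat v W (Ex2s Xs p).
Proof.
move=> TM fW cc p1 p2; rewrite -(mix_evens_odds u) -(mix_evens_odds (evens u)).
have relsW n q w : core Rs q -> rels M n (section W q w).
  exact: model_section.
move/(witnessed_sat relsW (@core_base Rs) cc).
apply: (iffLR (sat_ext _ _)) => [x|X /p2 XRs]; first by rewrite p1.
exact: sections_base.
Qed.

Definition bounded_witness Rs (e : nat -> relvar -> formula) Xs p N : upred :=
  fun M W v => exists2 n, n < N & witnessed (base Rs) (e n) Xs p W v.

(** * The defining sentence *)

(** Otherwise models [M N] violating each bound [N] have an ultraproduct where neither definition of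
    [Q] can be decided by a definable witness. *)
Lemma witness_bound Rs Q e Xs p Ys q : enumerates Rs e ->
    first_order p -> first_order q ->
    proves sigma11_AC0_wo (All2s Rs (Iff Q (Ex2s Xs p))) ->
    proves sigma11_AC0_wo (All2s Rs (Iff Q (All2s Ys q))) ->
  exists N, forall M (W : assignment2 M), is_model sigma11_AC0_wo M -> full W ->
    exists u, bounded_witness Rs e Xs p N W u \/
              bounded_witness Rs e Ys (Not q) N W u.
Proof.
move=> ee fp fq Qp Qq; apply: contrapT => noN.
have bad N : exists MW : {M : henkin & assignment2 M},
    [/\ is_model sigma11_AC0_wo (projT1 MW), full (projT2 MW) & forall u,
      ~ (bounded_witness Rs e Xs p N (projT2 MW) u \/
         bounded_witness Rs e Ys (Not q) N (projT2 MW) u)].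
  apply: contrapT => nbad; apply: noN; exists N => M W TM fW.
  apply: contrapT => nu; apply: nbad; exists (existT _ M W); split=> // u wu.
  by apply: nu; exists u.
pose M N := projT1 (projT1 (cid (bad N))).
pose W N : assignment2 (M N) := projT2 (projT1 (cid (bad N))).
have [TM fW nW] : [/\ forall N, is_model sigma11_AC0_wo (M N),
    forall N, full (W N) & forall N u,
      ~ (bounded_witness Rs e Xs p N (W N) u \/
         bounded_witness Rs e Ys (Not q) N (W N) u)].
  by split=> N; case: (projT2 (cid (bad N))).
(* Extending the filter of final segments makes [U] non-principal, as saturation requires. *)
have [U [UU cofU]] := ultraFilterLemma eventually_filter.
have {}cofU N : U [set i | N <= i]%classic by apply: cofU; exists N.
pose B := ultraproduct U Rs W.
have TB : is_model sigma11_AC0_wo B by apply: ultraproduct_model.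
pose WB : assignment2 B := @urel U Rs M W.
have relsB : rels_definable Rs WB := @ultraproduct_rels U UU Rs M W.
have [a _] := carrier_neq0 B.
pose V := sections WB (base Rs) (fun=> a).
have fV : full V.
  by move=> X; apply: (rels_section relsB); apply: core_base.
(* A witness in [B] moves to some factor [i > n], where the bound [i] excludes it. *)
have transfer Zs r n (u : assignment1 B) : first_order r ->
    witnessed (base Rs) (e n) Zs r WB u ->
    exists i u', n < i /\ witnessed (base Rs) (e n) Zs r (W i) u'.
  move=> fr wu; have dw := def_witnessed Zs fr (@core_base Rs) (proj1 ee n).
  move/(los_ucoord UU u dw): wu => wu.
  have [i [wi ni]] := filter_ex (filterI wu (cofU n.+1)).
  by exists i; eexists; split; [exact: ni|exact: wi].
have iffp := iffLR (valid_All2s _ _ _) (Qp B TB) (fun=> a) V fV.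
have iffq := iffLR (valid_All2s _ _ _) (Qq B TB) (fun=> a) V fV.
have [satp|nsatp] := pselect (sat (fun=> a) V (Ex2s Xs p)).
  have [n [z wn]] := sat_witnessed relsB ee fp (@core_base Rs) satp.
  have [i [u [ni wi]]] := transfer _ _ _ _ fp wn.
  by apply: (nW i u); left; exists n.
(* When the existential definition fails, [Q] fails, hence so does the universal one, and [Not q]
   has witnesses [Ys]. *)
have satq : sat (fun=> a) V (Ex2s Ys (Not q)).
  apply: contrapT => /sat_All2s_Not satq; apply: nsatp.
  by case: iffp => h _; apply: h; case: iffq => _; apply.
have [n [z wn]] := sat_witnessed relsB ee
  (fq : first_order (Not q)) (@core_base Rs) satq.
have [i [u [ni wi]]] := transfer _ _ _ _ (fq : first_order (Not q)) wn.
by apply: (nW i u); right; exists n.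
Qed.

(** Only the finitely many free variables of the defining formula need to be quantified. *)
Lemma def_ex_closed Rs P : def Rs P ->
  exists p, [/\ core Rs p, fv1 p = [::] &
    forall M (W : assignment2 M) v, sat v W p <-> exists u, P M W u].
Proof.
case=> p cp Pp; exists (Ex1s (fv1 p) p); split=> [||M W v].
- by elim: (fv1 p) => //= x xs cs; constructor.
- rewrite fv1_Ex1s; apply/eqP; rewrite -[_ == _]negbK -has_filter -all_predC.
  by apply/allP => y /= yp; rewrite yp.
rewrite sat_Ex1s; split=> [[u _ /Pp]|[u /Pp pu]]; first by exists u.
exists (fun y => if y \in fv1 p then u y else v y).
  by move=> y /negPf ->.
by apply: (iffLR (sat_ext _ _)) pu => // y ->.
Qed.

(* A tautology that makes every variable in Xs occur free, as definable_by
   requires. *)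
Definition mention (Xs : seq relvar) : formula :=
  foldr (fun X p =>
    let t := @Rel X [tuple of nseq (arity X) 0] in And (All1 0 (Imp t t)) p)
    (All1 0 (Eq1 0 0)) Xs.

Lemma mentionP Xs : [/\ first_order (mention Xs), fv1 (mention Xs) = [::],
  fv2 (mention Xs) =i Xs & forall M (v : assignment1 M) V, sat v V (mention Xs)].
Proof.
elim: Xs => [//|X Xs [f1 f2 f3 f4]]; split=> [||Y|M v V].
- exact: f1.
- pose zs := nseq (arity X) 0.
  change ([seq y <- zs ++ zs | y != 0] ++ fv1 (mention Xs) = [::]).
  rewrite f2 cats0; apply/eqP; rewrite -[_ == _]negbK -has_filter -all_predC.
  by apply/allP => y; rewrite mem_cat orbb mem_nseq => /andP[_ /eqP ->].
- by rewrite !inE f3 orbA orbb.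
- by split; [move=> a | exact: f4].
Qed.

Theorem theorem11p2 (Rs : seq relvar) (Q : formula) :
  generalized_quantifier Rs Q ->
  delta11_definable sigma11_AC0_wo Rs Q ->
  first_order_definable sigma11_AC0_wo Rs Q.
Proof.
move=> _ [[Phi [sPhi Phi1 Phi2 QPhi]] [Psi [sPsi Psi1 Psi2 QPsi]]].
have [Xs [p [fp PhiE]]] := sigma11_Ex2s sPhi.
have [Ys [q [fq PsiE]]] := pi11_All2s sPsi.
have [e ee] := ex_enumerates Rs; have [ce _] := ee.
rewrite {}PhiE in Phi1 Phi2 QPhi; rewrite {}PsiE in Psi1 Psi2 QPsi.
have [N hN] := witness_bound ee fp fq QPhi QPsi.
have dW : def Rs (bounded_witness Rs e Xs p N).
  by apply: def_bigor => n; apply: def_witnessed => //; apply: core_base.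
have [r [cr r1 rE]] := def_ex_closed dW.
have [fm m1 m2 mT] := mentionP Rs.
exists (And (mention Rs) r); split=> [||X|M TM].
- by rewrite /= fm (core_first_order cr).
- by rewrite /= m1 r1.
- rewrite /= mem_cat m2; case XRs : (X \in Rs) => //=.
  by apply/negbTE; apply: contraFN XRs; apply: core_fv2.
apply/valid_All2s => v V fV.
have Qp := iffLR (valid_All2s _ _ _) (QPhi M TM) v V fV.
have Qq := iffLR (valid_All2s _ _ _) (QPsi M TM) v V fV.
have rPhi : sat v V r -> sat v V (Ex2s Xs p).
  move=> /rE[u [n _ wn]]; apply: witnessed_base_sat wn => // X.
  by rewrite Phi2.
have [E1 E2] := fv_Ex2s_All2s Ys q.
have rPsi u : bounded_witness Rs e Ys (Not q) N V u -> ~ sat v V (All2s Ys q).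
  move=> [n _ wn] /sat_All2s_Not; apply; apply: witnessed_base_sat wn => //.
    by rewrite E1.
  by move=> X; rewrite E2 Psi2.
(* If [Q] holds, no bounded witness against it exists, so [witness_bound] yields one in its
   favour. *)
have Qr : sat v V Q -> sat v V r.
  move=> satQ; have [u [wu|/rPsi[]]] := hN M V TM fV; last first.
    by case: Qq => h _; apply: h.
  by apply/rE; exists u.
by split=> [/Qr|[_ /rPhi]]; [split; first exact: mT|case: Qp => _; apply].
Qed.
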